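(* Every coherent configuration of type $(2,2;3)$, $(3,2;3)$, or $(3,3;3)$ is $P$-polynomial.
   Context: **Coherent configurations.** A coherent configuration is a pair $\mathcal C=(X,\mathcal R)$, where $X$ is a nonempty finite set and $\mathcal R=\{R_i\mid i\in I\}$ is a partition of $X\times X$ into nonempty sets such that: if $R_i$ meets $\operatorname{diag}(X\times X)=\{(x,x)\mid x\in X\}$ then $R_i\subseteq\operatorname{diag}(X\times X)$; the transpose of each $R_i$ is in $\mathcal R$; and for all $i,j,h\in I$ the number $|\{z\in X\mid (x,z)\in R_i,(z,y)\in R_j\}|$ does not depend on the choice of $(x,y)\in R_h$. Let $\Omega\subseteq I$ be such that $\operatorname{diag}(X\times X)=\bigsqcup_{i\in\Omega}R_i$. For $i\in\Omega$ the fiber $X_i$ is the set of $x$ with $(x,x)\in R_i$; the fibers partition $X$, and each relation is contained in a single $X_i\times X_j$. Put $\varepsilon_{i,j}=1-\delta_{i,j}$, $I^{(i,j)}=\{\ell\in I\mid R_\ell\subseteq X_i\times X_j\}$, $r_{i,j}=|I^{(i,j)}|-\delta_{i,j}$, $\widetilde r_{i,j}=r_{i,j}-\varepsilon_{i,j}$. The relations in $X_i\times X_j$ are numbered $R^{(i,j)}_\ell$, $\varepsilon_{i,j}\le\ell\le r_{i,j}$, with $R_0^{(i,i)}=\operatorname{diag}(X_i\times X_i)$ and with $R^{(j,i)}_\ell$ the transpose of $R^{(i,j)}_\ell$. Let $A^{(i,j)}_\ell$ be the adjacency matrix of $R^{(i,j)}_\ell$ (indexed by $X\times X$, or equivalently,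 as a block, by $X_i\times X_j$), and $\mathcal A^{(i,j)}=\operatorname{span}_{\mathbb C}\{A_\ell^{(i,j)}\}$. **Type.** The type is the matrix $(|I^{(i,j)}|)_{i,j\in\Omega}$. Type $(a,b;c)$ means there are exactly two fibers $X_1,X_2$ with $|I^{(1,1)}|=a$, $|I^{(1,2)}|=|I^{(2,1)}|=b$, $|I^{(2,2)}|=c$. **Standing assumptions.** Each fiber carries a symmetric association scheme (all $R^{(i,i)}_\ell$ symmetric), and there are matrices $E_h^{(i,j)}$ ($i,j\in\Omega$, $0\le h\le\widetilde r_{i,j}$) such that: (B1) $E_0^{(i,j)}=\frac1{\sqrt{|X_i||X_j|}}J$ on the block $X_i\times X_j$ ($J$ all-ones); (B2) $\{E_h^{(i,j)}\}_{h}$ is a basis of $\mathcal A^{(i,j)}$; (B3) the transpose of $E_\ell^{(i,j)}$ is $E_\ell^{(j,i)}$; (B4) $E_\ell^{(i,j)}E_{\ell'}^{(i',j')}=\delta_{j,i'}\delta_{\ell,\ell'}E_\ell^{(i,j')}$. The eigenvalues $P_\ell^{(i,j)}(h)$ are defined by $A_\ell^{(i,j)}=\sum_{h=0}^{\widetilde r_{i,j}}P_\ell^{(i,j)}(h)E_h^{(i,j)}$. **$P$-polynomial.** $\mathcal C$ is $P$-polynomial if for every $i,j\in\Omega$ there is an ordering $A^{(i,j)}_{\varepsilon_{i,j}},\dots,A^{(i,j)}_{r_{i,j}}$ of the adjacency matrices of the block (with $A_0^{(i,i)}$ the identity of $X_i$) such that $P^{(i,j)}_{\varepsilon_{i,j}}(h)\ne0$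 for all $0\le h\le\widetilde r_{i,j}$ and, with $\overline{P_\ell^{(i,j)}}(h)=P_\ell^{(i,j)}(h)/P_{\varepsilon_{i,j}}^{(i,j)}(h)$, there are polynomials $v^{(i,j)}_\ell$ ($\varepsilon_{i,j}\le\ell\le r_{i,j}$) with $\deg v_\ell^{(i,j)}=\ell-\varepsilon_{i,j}$ and $\overline{P_\ell^{(i,j)}}(h)=v_\ell^{(i,j)}\bigl(\overline{P_{1+\varepsilon_{i,j}}^{(i,j)}}(h)\bigr)$ for all $0\le h\le\widetilde r_{i,j}$. (Orderings may be chosen separately for each block.) *)

(* Defs.v *)
From mathcomp Require Import all_boot all_order all_algebra.
From mathcomp Require Import complex reals.

Set Implicit Arguments.
Unset Strict Implicit.
Unset Printing Implicit Defensive.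

Import GRing.Theory Num.Theory.
Local Open Scope ring_scope.

Section CoherentConfigurations.
Variable X : finType.

(* Relations on X are sets of pairs. *)
Implicit Types (R S T i j : {set X * X}) (A : {set X}).

Definition diag A : {set X * X} := [set p in setX A A | p.1 == p.2].

Definition transp R : {set X * X} := [set p | (p.2, p.1) \in R].

(* The parts of a [partition] are nonempty. *)
Record coherent_configuration := CoherentConfiguration {
  rels : {set {set X * X}};
  cc_nonempty : (0 < #|X|)%N;
  cc_partition : partition rels [set: X * X];
  cc_diag : forall R, R \in rels ->
    R :&: diag [set: X] != set0 -> R \subset diag [set: X];
  cc_transp : forall R, R \in rels -> transp R \in rels;
  cc_intersection : forall R S T, R \in rels -> S \in rels -> T \in rels ->
    forall p q, p \in T -> q \in T ->
      #|[set z | ((p.1, z) \in R) && ((z, p.2) \in S)]|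
      = #|[set z | ((q.1, z) \in R) && ((z, q.2) \in S)]|
}.

(* The relations serve as their own indices, so Omega is the set of diagonal
   relations, and these index the fibers. *)
Definition Omega (C : coherent_configuration) : {set {set X * X}} :=
  [set R in rels C | R \subset diag [set: X]].

Definition fiber i : {set X} := [set x | (x, x) \in i].

Definition block_rels (C : coherent_configuration) i j : {set {set X * X}} :=
  [set R in rels C | R \subset setX (fiber i) (fiber j)].

Definition eps i j : nat := i != j.

Definition rr (C : coherent_configuration) i j : nat :=
  (#|block_rels C i j| - (i == j))%N.

Definition rrt (C : coherent_configuration) i j : nat :=
  (rr C i j - eps i j)%N.

Definition has_type (C : coherent_configuration) (a b c : nat) : Prop :=
  exists i1 i2,
    [/\ i1 != i2, Omega C = [set i1; i2],
        #|block_rels C i1 i1| = a,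
        #|block_rels C i1 i2| = b /\ #|block_rels C i2 i1| = b
      & #|block_rels C i2 i2| = c].

Definition symmetric_fibers (C : coherent_configuration) : Prop :=
  forall i R, i \in Omega C -> R \in block_rels C i i -> transp R = R.

Section Matrices.
Variables (K : numClosedFieldType) (C : coherent_configuration).

(* Matrices of every block are extended by zero to all of X * X, whose rows and
   columns are numbered through the enumeration of X. *)
Definition adj R : 'M[K]_#|X| :=
  \matrix_(x, y) ((enum_val x, enum_val y) \in R)%:R.

Definition block_space i j : {vspace 'M[K]_#|X|} :=
  <<[seq adj R | R <- enum (block_rels C i j)]>>%VS.

(* [E i j h] is $E_h^{(i,j)}$, which is meaningful for i, j in Omega and
   h <= rrt C i j only; other values are unconstrained. *)
Variable E : {set X * X} -> {set X * X} -> nat -> 'M[K]_#|X|.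

Definition E_block i j : (rrt C i j).+1.-tuple 'M[K]_#|X| :=
  [tuple E i j h | h < (rrt C i j).+1].

Record matrix_unit_basis : Prop := MatrixUnitBasis {
  mub_B1 : forall i j, i \in Omega C -> j \in Omega C ->
    E i j 0%N = (sqrtC (#|fiber i| * #|fiber j|)%N%:R)^-1
                  *: adj (setX (fiber i) (fiber j));
  mub_B2 : forall i j, i \in Omega C -> j \in Omega C ->
    basis_of (block_space i j) (E_block i j);
  mub_B3 : forall i j h, i \in Omega C -> j \in Omega C ->
    (h <= rrt C i j)%N -> (E i j h)^T = E j i h;
  mub_B4 : forall i j i' j' h h', i \in Omega C -> j \in Omega C ->
    i' \in Omega C -> j' \in Omega C ->
    (h <= rrt C i j)%N -> (h' <= rrt C i' j')%N ->
    E i j h *m E i' j' h' = if (j == i') && (h == h') then E i j' h else 0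
}.

(* $P_R^{(i,j)}(h)$: the coefficient of E i j h in the adjacency matrix of a
   relation R of the block, when E_block i j is a basis of block_space i j. *)
Definition eigval i j R (h : 'I_(rrt C i j).+1) : K :=
  coord (E_block i j) h (adj R).

Definition eigval_bar i j (rho : nat -> {set X * X}) (l : nat)
    (h : 'I_(rrt C i j).+1) : K :=
  eigval (rho l) h / eigval (rho (eps i j)) h.

(* [rho l] is the relation $R_l^{(i,j)}$, for eps i j <= l <= rr C i j. *)
Definition block_ordering i j (rho : nat -> {set X * X}) : Prop :=
  perm_eq [seq rho l | l <- index_iota (eps i j) (rr C i j).+1]
          (enum (block_rels C i j))
  /\ (i = j -> rho 0%N = diag (fiber i)).

Definition P_polynomial : Prop :=
  forall i j, i \in Omega C -> j \in Omega C ->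
  exists rho : nat -> {set X * X},
    [/\ block_ordering i j rho,
        forall h : 'I_(rrt C i j).+1, eigval (rho (eps i j)) h != 0
      & exists v : nat -> {poly K},
          forall l, (eps i j <= l <= rr C i j)%N ->
            size (v l) = (l - eps i j).+1%N
            /\ forall h : 'I_(rrt C i j).+1,
                 eigval_bar rho l h
                 = (v l).[eigval_bar rho (1 + eps i j)%N h]].

End Matrices.
End CoherentConfigurations.

(* Main.v *)
Require Import Defs.
From mathcomp Require Import all_boot all_order all_algebra.
From mathcomp Require Import complex reals.
From mathcomp Require Import zify ring.

Set Implicit Arguments.
Unset Strict Implicit.
Unset Printing Implicit Defensive.

Import Order.TTheory GRing.Theory Num.Theory.
Local Open Scope ring_scope.

(** Only the blocks of two or three relations matter: in these three types
every block is one, and the orderings are chosen block by block. In a block let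
[P R h] be the coefficient of [E_h] in the adjacency matrix of [R]. Three facts
are used. The adjacency matrices of the block sum to a nonzero multiple of
[E_0], so [P R h] summed over [R] is zero exactly when [h != 0]
([sum_eigval]); [P R 0] is positive ([eigval0_gt0]); and no [h] has [P R h = 0]
for all [R], since the adjacency matrices span the block ([eigval_neq0]).

With two relations it suffices that the first one has no zero eigenvalue, and
the polynomials are [1] and [x]. With three relations [A], [B], [D], put
[x_h = P B h / P A h]. Then [P D h / P A h] is [-1 - x_h] for [h != 0] and
differs from it for [h = 0], so it is a quadratic polynomial in [x_h] as soon as
[x_0] differs from the two other [x_h] ([block_P_polynomial3]). So an ordered
pair [(A, B)] is needed with [P A] nowhere zero and [x_h != x_0] for the two
nonzero [h].

Between two distinct fibers such a pair exists by counting: each nonzero [h]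
excludes at most two of the six ordered pairs ([obstructed_pairs_le2]), so at
least two pairs remain. Inside a fiber [A] has to be the diagonal, for which
[P A h = 1]. If neither other relation could be taken as [B], then either some
[h] makes both graphs have their valency as eigenvalue, which contradicts the
sum over the block, or the two nonzero [h] do this one for each graph, so that
the product of [adj B - P B 0] and [adj D - P D 0] vanishes on the fiber; its
diagonal entries are [P B 0 * P D 0], which is not zero
([two_relations_connected]). This is the fact that a graph and its complement
are not both disconnected. *)

(** * Relations and fibers *)

Section Relations.
Variables (X : finType) (C : coherent_configuration X).
Implicit Types (R S i j : {set X * X}).

Lemma rels_disjoint R S p :
  R \in rels C -> S \in rels C -> p \in R -> p \in S -> R = S.
Proof.
have [_ tI _] := and3P (cc_partition C).
by move=> RC SC pR pS; rewrite -(def_pblock tI RC pR) (def_pblock tI SC pS).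
Qed.

Lemma rels_neq0 R : R \in rels C -> exists p, p \in R.
Proof.
have [_ _ n0] := and3P (cc_partition C).
by move=> RC; apply/set0Pn; apply: contraNneq n0 => <-.
Qed.

Lemma Omega_diag i : i \in Omega C -> i = diag (fiber i).
Proof.
rewrite inE => /andP[_ /subsetP id]; apply/setP => -[x y].
rewrite !inE /=; apply/idP/idP => [xyi|/andP[/andP[xi _] /eqP <- //]].
by have := id _ xyi; rewrite !inE /= => /eqP exy; rewrite {2}exy exy in xyi *;
  rewrite xyi eqxx.
Qed.

Lemma mem_Omega i x y : i \in Omega C ->
  (x, y) \in i = (x == y) && (x \in fiber i).
Proof.
move=> iO; rewrite {1}(Omega_diag iO) !inE /=.
by case: eqP => [->|_]; rewrite ?andbT ?andbF ?andbb.
Qed.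

(** A relation meeting a product of two fibers lies inside it: the number of
    [z] with [(x, z) \in i] and [(z, y) \in R] is [1] or [0] according to
    whether [x] is in the fiber of [i], and it is constant on [R]; similarly for
    [y] and [j]. *)
Lemma rel_sub_block i j R p : i \in Omega C -> j \in Omega C ->
  R \in rels C -> p \in R -> p \in setX (fiber i) (fiber j) ->
  R \in block_rels C i j.
Proof.
move=> iO jO RC; case: p => x y pR; rewrite in_setX /= => /andP[p1 p2].
have [iC jC]: i \in rels C /\ j \in rels C.
  by move: iO jO; rewrite !inE => /andP[-> _] /andP[->].
rewrite inE RC /=; apply/subsetP => q qR.
rewrite [q]surjective_pairing in_setX /=.
apply/andP; split.
- have : (0 < #|[set z | ((q.1, z) \in i) && ((z, q.2) \in R)]|)%N.
    rewrite -(cc_intersection iC RC RC pR qR); apply/card_gt0P; exists x.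
    by rewrite inE (mem_Omega _ _ iO) eqxx p1.
  by case/card_gt0P => z; rewrite inE (mem_Omega _ _ iO) => /andP[/andP[_]].
- have : (0 < #|[set z | ((q.1, z) \in R) && ((z, q.2) \in j)]|)%N.
    rewrite -(cc_intersection RC jC RC pR qR); apply/card_gt0P; exists y.
    by rewrite inE (mem_Omega _ _ jO) eqxx p2 pR.
  case/card_gt0P => z; rewrite inE (mem_Omega _ _ jO).
  by move=> /andP[_ /andP[/eqP ->]].
Qed.

Lemma block_relsP i j R : R \in block_rels C i j ->
  R \in rels C /\ forall x y, (x, y) \in R -> x \in fiber i /\ y \in fiber j.
Proof.
rewrite inE => /andP[-> /subsetP sR]; split=> // x y /sR.
by rewrite in_setX => /andP.
Qed.

Lemma sum_adj_block (K : numClosedFieldType) i j :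
  i \in Omega C -> j \in Omega C ->
  \sum_(R in block_rels C i j) adj K R = adj K (setX (fiber i) (fiber j)).
Proof.
move=> iO jO; apply/matrixP => x y; rewrite summxE mxE.
set p := (_, _); under eq_bigr => R _ do rewrite mxE -/p.
have [pX|pX] := boolP (p \in _).
  have [/eqP covC _ _] := and3P (cc_partition C).
  have : p \in cover (rels C) by rewrite covC in_setT.
  case/bigcupP => R RC pR; have RB := rel_sub_block iO jO RC pR pX.
  rewrite (bigD1 R) //= pR big1 ?addr0 // => S /andP[SB].
  case pS: (p \in S) => // /eqP[].
  by have [SC _] := block_relsP SB; apply: rels_disjoint pS pR.
rewrite big1 // => R; rewrite inE => /andP[_ /subsetP/(_ p)].
by case: (p \in R) => // /(_ isT); rewrite (negPf pX).
Qed.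

Lemma Omega_block_rels i : i \in Omega C -> i \in block_rels C i i.
Proof.
move=> iO; have iC : i \in rels C by move: iO; rewrite inE => /andP[].
have [[x y] xyi] := rels_neq0 iC.
apply: (rel_sub_block iO iO iC xyi); move: (xyi); rewrite mem_Omega //.
by rewrite in_setX => /andP[/eqP <- ->].
Qed.

Lemma fiber_gt0 k : k \in Omega C -> (0 < #|fiber k|)%N.
Proof.
move=> kO; have [kC kf] := block_relsP (Omega_block_rels kO).
have [[x y] /kf[xk _]] := rels_neq0 kC.
by apply/card_gt0P; exists x.
Qed.

Lemma rrtS i j : (0 < #|block_rels C i j|)%N ->
  (rrt C i j).+1 = #|block_rels C i j|.
Proof. by rewrite /rrt /rr /eps; case: eqP; lia. Qed.

Lemma rrS i j : (0 < #|block_rels C i j|)%N ->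
  (rr C i j).+1 = (eps i j + #|block_rels C i j|)%N.
Proof. by rewrite /rr /eps; case: eqP; lia. Qed.

End Relations.

Lemma perm_eq3 (T : eqType) (x y z : T) :
  [/\ perm_eq [:: x; z; y] [:: x; y; z], perm_eq [:: y; x; z] [:: x; y; z],
      perm_eq [:: y; z; x] [:: x; y; z], perm_eq [:: z; x; y] [:: x; y; z]
    & perm_eq [:: z; y; x] [:: x; y; z]].
Proof.
by split; apply/seq.permP => p /=;
  move: (nat_of_bool (p x)) (nat_of_bool (p y)) (nat_of_bool (p z)) => ???; lia.
Qed.

(** * Counting admissible ordered pairs of relations *)

Section Counting.
Variable K : numFieldType.

(** For a fixed [h], if [x] and [y] are the quotients [P R h / P R 0] of two
    relations, this says that [h] prevents placing the first relation first and
    the second one next. *)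
Definition obstructed (x y : K) := (x == 0) || (x == y).

(** If two of three numbers with vanishing positively weighted sum agree, then
    the third is a negative multiple of their common value. *)
Lemma weighted_sum0_equal_pair (a b c u v : K) : 0 < a -> 0 < b -> 0 < c ->
  a * u + b * u + c * v = 0 -> (u != 0) || (v != 0) ->
  [/\ (u == 0) = false, (v == 0) = false & (u == v) = false].
Proof.
move=> a0 b0 c0 e uv.
have ab0 : 0 < a + b by rewrite addr_gt0.
have u0 : u != 0.
  apply: contraL uv => /eqP u0; rewrite u0 eqxx negbK.
  by move/eqP: e; rewrite u0 !mulr0 !add0r mulf_eq0 gt_eqF.
rewrite (negPf u0); split=> //; apply: contraNF u0 => /eqP vE; move/eqP: e.
  by rewrite vE mulr0 addr0 -mulrDl mulf_eq0 gt_eqF.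
by rewrite -vE -!mulrDl mulf_eq0 gt_eqF // addr_gt0.
Qed.

(** Either two of the numbers agree, and then none is zero and the third is
    different, so just that pair is obstructed, in both directions; or they are
    distinct, and then at most one is zero, which obstructs the two ordered
    pairs starting with it. *)
Lemma obstructed_pairs_le2 (k1 k2 k3 x y z : K) :
  0 < k1 -> 0 < k2 -> 0 < k3 -> k1 * x + k2 * y + k3 * z = 0 ->
  [|| x != 0, y != 0 | z != 0] ->
  (obstructed x y + obstructed x z + obstructed y x + obstructed y z
   + obstructed z x + obstructed z y <= 2)%N.
Proof.
move=> k1p k2p k3p e n0.
rewrite /obstructed (eq_sym y x) (eq_sym z x) (eq_sym z y).
have [xy|xy] := eqVneq x y.
  have [] := @weighted_sum0_equal_pair k1 k2 k3 x z => //.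
  - by rewrite -e xy.
  - by move: n0; rewrite xy orbA orbb.
  by rewrite -xy => -> -> ->.
have [xz|xz] := eqVneq x z.
  have [] := @weighted_sum0_equal_pair k1 k3 k2 x y => //.
  - by rewrite -e xz; ring.
  - by move: n0; rewrite xz; case: (z == 0); case: (y == 0).
  by rewrite -xz (eq_sym y x) (negPf xy) => -> -> _.
have [yz|yz] := eqVneq y z.
  have [] := @weighted_sum0_equal_pair k2 k3 k1 y x => //.
  - by rewrite -e yz; ring.
  - by move: n0; rewrite yz orbb orbC.
  by rewrite -yz => -> -> _.
move: xy xz yz; have [-> | _] := eqVneq x 0.
  by rewrite ![0 == _]eq_sym => /negPf-> /negPf->.
have [-> _ | _ _ _ _] := eqVneq y 0; last by case: (z == 0).
by move=> _; rewrite eq_sym => /negPf->.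
Qed.
End Counting.

(** * Eigenvalues of a block *)

Section Eigenvalues.
Variables (K : numClosedFieldType) (X : finType).
Variables (C : coherent_configuration X).
Variable E : {set X * X} -> {set X * X} -> nat -> 'M[K]_#|X|.
Hypothesis basisE : matrix_unit_basis C E.

Section Block.
Variables i j : {set X * X}.
Hypotheses (iO : i \in Omega C) (jO : j \in Omega C).
Implicit Types (R S : {set X * X}) (h : 'I_(rrt C i j).+1).
Notation P := (@eigval X K C E i j).

Let basisB := mub_B2 basisE iO jO.

Lemma adj_eigval R : R \in block_rels C i j ->
  adj K R = \sum_h P R h *: E i j h.
Proof.
move=> RB; have : adj K R \in <<E_block C E i j>>%VS.
  rewrite (span_basis basisB); apply: memv_span.
  by apply/mapP; exists R; rewrite ?mem_enum.
move/coord_span => {1}->; apply: eq_bigr => h _.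
by rewrite -tnth_nth tnth_mktuple.
Qed.

Lemma coord_E h h' : coord (E_block C E i j) h (E i j h') = (h == h')%:R.
Proof.
have -> : E i j h' = (E_block C E i j)`_h' by rewrite -tnth_nth tnth_mktuple.
by rewrite coord_free ?(basis_free basisB) // eq_sym.
Qed.

(** If the coordinate along [E_h] vanished on all adjacency matrices, it would
    vanish on their span, which contains [E_h]. *)
Lemma eigval_neq0 h : exists2 R, R \in block_rels C i j & P R h != 0.
Proof.
apply/exists_inP; apply: contraT => /exists_inPn P0.
have Eh : E i j h \in block_space K C i j.
  by apply: (basis_mem basisB); apply/tnthP; exists h; rewrite tnth_mktuple.
have := coord_E h h; rewrite eqxx.
rewrite (coord_span (X := in_tuple _) Eh) linear_sum big1 => [/eqP|k _].
  by rewrite eq_sym oner_eq0.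
rewrite linearZ /=; have [R RB ->] : exists2 R, R \in block_rels C i j &
    (in_tuple [seq adj K R | R <- enum (block_rels C i j)])`_k = adj K R.
  rewrite -tnth_nth; have /mapP[R] := mem_tnth k
    (in_tuple [seq adj K R | R <- enum (block_rels C i j)]).
  by rewrite mem_enum => RB ->; exists R.
by have := P0 _ RB; rewrite negbK => /eqP; rewrite /eigval => ->; rewrite mulr0.
Qed.

Lemma sum_eigval : exists2 s : K, s != 0 &
  forall h, \sum_(R in block_rels C i j) P R h = s * (h == ord0)%:R.
Proof.
exists (sqrtC (#|fiber i| * #|fiber j|)%N%:R) => [|h].
  by rewrite sqrtC_eq0 pnatr_eq0 -lt0n muln_gt0 !(@fiber_gt0 X C).
rewrite -linear_sum sum_adj_block //= -(coord_E h ord0) -linearZ /=.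
rewrite (mub_B1 basisE iO jO) scalerA divff ?scale1r //.
by rewrite sqrtC_eq0 pnatr_eq0 -lt0n muln_gt0 !(@fiber_gt0 X C).
Qed.

(** Multiplying by the constant block [E_0^(j,i)] isolates the [h = 0] term:
    [A_R E_0^(j,i) = P R 0 E_0^(i,i)]. At a diagonal position [(x, x)] where [x]
    has a neighbour in [R], the left side is positive. *)
Lemma eigval0_gt0 R : R \in block_rels C i j -> 0 < P R ord0.
Proof.
move=> RB; have [RC Rf] := block_relsP RB.
have [[x y] xyR] := rels_neq0 RC; have [xi yj] := Rf _ _ xyR.
have : adj K R *m E j i 0 = P R ord0 *: E i i 0.
  rewrite adj_eigval // mulmx_suml (bigD1 ord0) //= -scalemxAl.
  rewrite (mub_B4 basisE) // !eqxx /= big1 ?addr0 // => h h0.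
  rewrite -scalemxAl (mub_B4 basisE) ?leq_ord // ?eqxx.
  by rewrite -[_ == 0%N]/(h == ord0) (negPf h0) scaler0.
move/matrixP/(_ (enum_rank x) (enum_rank x)).
rewrite !(mub_B1 basisE) // !mxE.
rewrite enum_rankK in_setX xi mulr1.
have pos a b : a \in Omega C -> b \in Omega C ->
    0 < (sqrtC (#|fiber a| * #|fiber b|)%N%:R : K)^-1.
  by move=> aO bO; rewrite invr_gt0 sqrtC_gt0 ltr0n muln_gt0 !(@fiber_gt0 X C).
move=> e; rewrite -(pmulr_lgt0 _ (pos _ _ iO iO)) -e.
rewrite (bigD1 (enum_rank y)) //= !mxE !enum_rankK xyR in_setX yj xi.
rewrite /= mul1r mulr1.
apply: ltr_pwDl; first exact: pos.
apply: sumr_ge0 => z _; rewrite !mxE !mulr_ge0 ?ler0n //.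
exact/ltW/pos.
Qed.

End Block.

Section Fiber.
Variable i : {set X * X}.
Hypothesis iO : i \in Omega C.
Notation P := (@eigval X K C E i i).

Lemma adj_mul R S : R \in block_rels C i i -> S \in block_rels C i i ->
  adj K R *m adj K S = \sum_h (P R h * P S h) *: E i i h.
Proof.
move=> RB SB; rewrite (adj_eigval iO iO RB) (adj_eigval iO iO SB) mulmx_suml.
apply: eq_bigr => h _; rewrite mulmx_sumr (bigD1 h) //= big1 => [|k kh].
  rewrite -scalemxAl -scalemxAr (mub_B4 basisE) ?leq_ord // !eqxx /=.
  by rewrite addr0 scalerA.
rewrite -scalemxAl -scalemxAr (mub_B4 basisE) ?leq_ord // eqxx /=.
by rewrite -[_ == _ :> nat]/(h == k) eq_sym (negPf kh) !scaler0.
Qed.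

Lemma adj_Omega_mul R : R \in block_rels C i i -> adj K i *m adj K R = adj K R.
Proof.
case/block_relsP=> _ Rf; apply/matrixP => x y; rewrite mxE (bigD1 x) //= big1.
  rewrite !mxE (mem_Omega _ _ iO) eqxx addr0 /=.
  case: (boolP (_ \in R)) => [/Rf[-> _]|_]; by rewrite ?mulr0 ?mulr1.
move=> z zx; rewrite !mxE (mem_Omega _ _ iO) (inj_eq enum_val_inj) eq_sym.
by rewrite (negPf zx) mul0r.
Qed.

(** The diagonal relation acts as a left identity on the block, and every [h]
    has a relation with a nonzero eigenvalue to cancel. *)
Lemma eigval_diag h : P i h = 1.
Proof.
have [R RB RN0] := eigval_neq0 iO iO h.
apply: (mulIf RN0); rewrite mul1r.
have := adj_mul (Omega_block_rels iO) RB; rewrite adj_Omega_mul // => e.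
rewrite [RHS]/eigval e linear_sum (bigD1 h) //= linearZ /= (coord_E iO iO) eqxx.
rewrite mulr1 big1 ?addr0 // => k kh.
by rewrite linearZ /= (coord_E iO iO) eq_sym (negPf kh) mulr0.
Qed.

(** Otherwise [(P R h - P R 0) * (P S h - P S 0) = 0] for every [h], so the
    product of [A_R - P R 0] and [A_S - P S 0] vanishes on the fiber. Symmetry
    and disjointness of [R] and [S] give [A_R A_S] a zero diagonal, so the
    diagonal of the product is [P R 0 * P S 0], which is not zero. *)
Lemma two_relations_connected (symC : symmetric_fibers C) R S :
  R \in block_rels C i i -> S \in block_rels C i i ->
  R != i -> S != i -> R != S ->
  exists h, P R h != P R ord0 /\ P S h != P S ord0.
Proof.
move=> RB SB Ri Si RS.
have [RC _] := block_relsP RB; have [SC _] := block_relsP SB.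
have iB := Omega_block_rels iO; have [iC ifb] := block_relsP iB.
suff /existsP[h /andP[? ?]] :
  [exists h, (P R h != P R ord0) && (P S h != P S ord0)] by exists h.
apply: contraT => /existsPn Pn.
have : adj K R *m adj K S - P S ord0 *: adj K R - P R ord0 *: adj K S
    + (P R ord0 * P S ord0) *: adj K i = 0.
  rewrite adj_mul // (adj_eigval iO iO RB) (adj_eigval iO iO SB).
  rewrite (adj_eigval iO iO iB).
  rewrite !scaler_sumr -!sumrB -big_split /= big1 // => h _.
  rewrite !scalerA -!scalerBl -scalerDl eigval_diag.
  have -> : P R h * P S h - P S ord0 * P R h - P R ord0 * P S h
      + P R ord0 * P S ord0 * 1 = (P R h - P R ord0) * (P S h - P S ord0).
    by ring.
  have := Pn h; rewrite negb_and !negbK => /orP[] /eqP ->;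
    by rewrite subrr ?mul0r ?mulr0 scale0r.
have [x xi] : exists x, x \in fiber i by apply/card_gt0P/(fiber_gt0 iO).
have off T : T \in rels C -> T != i -> (x, x) \in T = false.
  move=> TC; apply: contraNF => xT.
  by apply/eqP/(rels_disjoint TC iC xT); rewrite (mem_Omega _ _ iO) eqxx.
move/matrixP/(_ (enum_rank x) (enum_rank x)).
rewrite !mxE !enum_rankK (off _ RC Ri) (off _ SC Si) (mem_Omega _ _ iO).
rewrite eqxx xi !mulr0 !subr0 mulr1.
rewrite big1 => [|z _]; last first.
  rewrite !mxE enum_rankK; case: (boolP ((x, _) \in R)) => xR;
    last by rewrite mul0r.
  case: (boolP (_ \in S)) => xS; last by rewrite mulr0.
  case/eqP: RS; apply: (rels_disjoint RC SC xR).
  by rewrite -(symC i S iO SB) inE.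
move/eqP; rewrite add0r mulf_eq0.
by rewrite !gt_eqF // (eigval0_gt0 iO iO).
Qed.

End Fiber.


(** * Orderings from separated eigenvalues *)

Definition block_P_polynomial i j : Prop :=
  exists rho : nat -> {set X * X},
    [/\ block_ordering C i j rho,
        forall h : 'I_(rrt C i j).+1, eigval E (rho (eps i j)) h != 0
      & exists v : nat -> {poly K},
          forall l, (eps i j <= l <= rr C i j)%N ->
            size (v l) = (l - eps i j).+1%N
            /\ forall h : 'I_(rrt C i j).+1,
                 eigval_bar E rho l h
                 = (v l).[eigval_bar E rho (1 + eps i j)%N h]].

Section Orderings.
Variables i j : {set X * X}.
Hypotheses (iO : i \in Omega C) (jO : j \in Omega C).
Implicit Types (h : 'I_(rrt C i j).+1) (s : seq {set X * X}).
Notation P := (@eigval X K C E i j).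

(** Reindexing by [l - eps i j] treats the blocks inside and outside the
    diagonal alike. *)
Lemma block_P_polynomial_of_seq s : s != [::] ->
  perm_eq s (enum (block_rels C i j)) ->
  (i = j -> nth set0 s 0 = diag (fiber i)) ->
  (forall h, P (nth set0 s 0) h != 0) ->
  (exists v : nat -> {poly K}, forall m, (m < size s)%N ->
     size (v m) = m.+1 /\
     forall h, P (nth set0 s m) h / P (nth set0 s 0) h
               = (v m).[P (nth set0 s 1) h / P (nth set0 s 0) h]) ->
  block_P_polynomial i j.
Proof.
move=> s0 sE sdiag sN0 [v vP].
have sz : size s = #|block_rels C i j| by rewrite (perm_size sE) cardE.
have s_gt0 : (0 < size s)%N by rewrite lt0n size_eq0.
have rrE : (rr C i j).+1 = (eps i j + size s)%N by rewrite sz rrS -?sz.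
exists (fun l => nth set0 s (l - eps i j)); split.
- split=> [|ij]; last by rewrite sub0n sdiag.
  suff -> : [seq nth set0 s (l - eps i j)
              | l <- index_iota (eps i j) (rr C i j).+1] = s by [].
  rewrite rrE /index_iota addKn -[X in iota X]addn0 iotaDl -map_comp.
  by under eq_map => l do rewrite /= addKn; rewrite map_nth_iota0 ?take_size.
- by move=> h; rewrite subnn.
- exists (fun l => v (l - eps i j)%N) => l /andP[le_l l_le].
  have [|-> vE] := vP (l - eps i j)%N; first by lia.
  by split=> // h; rewrite /eigval_bar subnn addnK -vE.
Qed.

(** Since [P A + P B + P D] vanishes away from [h = 0], the quotient by [P A]
    of the third eigenvalue is [-1 - x] there; correcting this polynomial by a
    multiple of the product of the [x - x_h], [h != 0], gives it the right
    value at [h = 0] and degree two. *)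
Lemma block_P_polynomial3 (A B D : {set X * X}) :
  perm_eq [:: A; B; D] (enum (block_rels C i j)) ->
  (i = j -> A = diag (fiber i)) ->
  (forall h, P A h != 0) ->
  (forall h, h != ord0 -> P B h / P A h != P B ord0 / P A ord0) ->
  block_P_polynomial i j.
Proof.
move=> sE Adiag AN0 BA.
have card3 : #|block_rels C i j| = 3%N by rewrite cardE -(perm_size sE).
have [s sN0 sumP] := sum_eigval iO jO.
have sumABD h : P A h + P B h + P D h = s * (h == ord0)%:R.
  by rewrite -sumP -big_enum -(perm_big _ sE) /= !big_cons big_nil addr0 addrA.
pose x h := P B h / P A h.
pose q := \prod_(h in predC1 ord0) ('X - (x h)%:P).
have q0 : q.[x ord0] != 0.
  rewrite horner_prod; apply/prodf_neq0 => h; rewrite inE => h0.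
  by rewrite !hornerE subr_eq0 eq_sym BA.
have size_q : size q = 3%N.
  rewrite /q -big_enum size_prod_XsubC.
  by rewrite -cardE cardC1 card_ord rrtS ?card3.
have qh h : h != ord0 -> q.[x h] = 0.
  move=> h0; rewrite horner_prod (bigD1 h) //= !hornerE subrr.
  by rewrite mul0r.
pose c := s / P A ord0 / q.[x ord0].
have cN0 : c != 0 by rewrite !mulf_neq0 ?invr_neq0.
apply: (@block_P_polynomial_of_seq [:: A; B; D]) => //.
exists (fun m => if m == 2%N then c *: q - 'X - 1 else 'X^m) => m m3.
case: eqP => [->|/eqP m2]; split.
- rewrite -addrA -opprD size_polyDl ?size_scale ?size_q //.
  by rewrite size_polyN size_XaddC.
- move=> h; rewrite /= !hornerE -/(x h).
  have -> : P D h = s * (h == ord0)%:R - P A h - P B h by rewrite -sumABD; ring.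
  rewrite !mulrBl divff // -/(x h).
  have [->|h0] := eqVneq h ord0; last by rewrite qh // !mulr0 mul0r; ring.
  by rewrite divfK // mulr1; ring.
- by rewrite size_polyXn.
- move=> h; rewrite hornerXn; case: m m3 m2 => [|[|[]]] //= _ _.
  by rewrite expr0 divff.
Qed.

Lemma block_P_polynomial2 (A B : {set X * X}) :
  perm_eq [:: A; B] (enum (block_rels C i j)) ->
  (i = j -> A = diag (fiber i)) ->
  (forall h, P A h != 0) -> block_P_polynomial i j.
Proof.
move=> sE Adiag AN0; apply: (@block_P_polynomial_of_seq [:: A; B]) => //.
exists (fun m => 'X^m) => m m2; split; first by rewrite size_polyXn.
move=> h; rewrite hornerXn; case: m m2 => [|[|[]]] //= _.
by rewrite expr0 divff.
Qed.


Hypotheses (rank3 : #|block_rels C i j| = 3%N).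

Lemma nonzero_index3 : exists h1 h2 : 'I_(rrt C i j).+1,
  [/\ h1 != ord0, h2 != ord0 & forall h, h != ord0 -> h = h1 \/ h = h2].
Proof.
have r2 : rrt C i j = 2%N by apply: succn_inj; rewrite rrtS ?rank3.
have lt1 : (1 < (rrt C i j).+1)%N by rewrite r2.
have lt2 : (2 < (rrt C i j).+1)%N by rewrite r2.
exists (Ordinal lt1), (Ordinal lt2); split=> // h h0.
have : (h < 3)%N by rewrite -r2 ltnS leq_ord.
by case: h h0 => [[|[|[|m]]] hm] // _ _; [left | right]; apply: val_inj.
Qed.

End Orderings.

(** * Blocks with two or three relations *)

(** Outside the diagonal any relation may come first: if its eigenvalue at
    [h != 0] were zero, so would be that of the other, their sum being zero. *)
Lemma P_polynomial_rank2 i j : i \in Omega C -> j \in Omega C ->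
  #|block_rels C i j| = 2%N -> block_P_polynomial i j.
Proof.
move=> iO jO card2; have [ij|ij] := eqVneq i j.
  rewrite -{j}ij in jO card2 *.
  have := perm_to_rem (x := i) (s := enum (block_rels C i i)).
  rewrite mem_enum => /(_ (Omega_block_rels iO)) sE.
  have sz := perm_size sE; move: sz sE; rewrite -cardE card2.
  case: (rem i _) => [|B []] //= _ sE.
  apply: (block_P_polynomial2 iO iO (A := i) (B := B)).
  - by rewrite perm_sym.
  - by move=> _; apply: Omega_diag iO.
  - by move=> h; rewrite eigval_diag // oner_eq0.
move: (cardE (block_rels C i j)); rewrite card2.
case E0: (enum _) => [|A [|B []]] // _.
have memAB R : R \in block_rels C i j = (R \in [:: A; B]).
  by rewrite -E0 mem_enum.
apply: (block_P_polynomial2 iO jO (A := A) (B := B)); rewrite ?E0 //.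
  by move=> e; rewrite e eqxx in ij.
move=> h; have [->|h0] := eqVneq h ord0.
  by rewrite gt_eqF // eigval0_gt0 // memAB mem_head.
have [s _ sumP] := sum_eigval iO jO.
apply/eqP => PA0; have := sumP h.
rewrite (negPf h0) mulr0 -big_enum E0 /= !big_cons big_nil.
rewrite PA0 add0r addr0 => PB0.
have [R] := eigval_neq0 iO jO h.
by rewrite memAB !inE => /orP[] /eqP ->; rewrite ?PA0 ?PB0 eqxx.
Qed.

Lemma P_polynomial_rank3_diag (symC : symmetric_fibers C) i : i \in Omega C ->
  #|block_rels C i i| = 3%N -> block_P_polynomial i i.
Proof.
move=> iO card3; pose P := @eigval X K C E i i.
have := perm_to_rem (x := i) (s := enum (block_rels C i i)).
rewrite mem_enum => /(_ (Omega_block_rels iO)) sE.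
have sz := perm_size sE; move: sz sE; rewrite -cardE card3.
case: (rem i _) => [|A [|B []]] //= _ sE.
have memAB R : R \in block_rels C i i = (R \in [:: i; A; B]).
  by rewrite -(perm_mem sE) mem_enum.
have /= /and3P[] : uniq [:: i; A; B] by rewrite -(perm_uniq sE) enum_uniq.
rewrite !inE negb_or ![i == _]eq_sym => /andP[Ai Bi] AB _.
have AB' : A \in block_rels C i i by rewrite memAB !inE eqxx orbT.
have BB : B \in block_rels C i i by rewrite memAB !inE eqxx !orbT.
have diagi : i = diag (fiber i) := Omega_diag iO.
have P_i h : P i h = 1 by apply: eigval_diag.
have [] : (forall h, h != ord0 -> P A h != P A ord0) \/
          (forall h, h != ord0 -> P B h != P B ord0).
- have [/forall_inP ? |/forall_inPn[a a0 /negPn/eqP Pa]] :=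
    boolP [forall (h | h != ord0), P A h != P A ord0]; first by left.
  have [/forall_inP ? |/forall_inPn[b b0 /negPn/eqP Pb]] :=
    boolP [forall (h | h != ord0), P B h != P B ord0]; first by right.
  (* If [a != b], the index [h] at which neither relation has its valency as
     eigenvalue would be a third nonzero one. *)
  have [ab|ab] := eqVneq a b; last first.
    have [h [hA hB]] := two_relations_connected iO symC AB' BB Ai Bi AB.
    have [h1 [h2 [_ _ h12]]] := nonzero_index3 card3.
    have h0 : h != ord0 by apply: contraNneq hA => ->.
    have ha : h != a by apply: contraNneq hA => ->; apply/eqP.
    have hb : h != b by apply: contraNneq hB => ->; apply/eqP.
    by move: ha hb ab; case: (h12 h h0) (h12 a a0) (h12 b b0) => -> [] -> [] ->;
      rewrite ?eqxx.
  have [s _ sumP] := sum_eigval iO iO; have := sumP a.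
  rewrite (negPf a0) mulr0 -big_enum (perm_big _ sE) /= !big_cons big_nil -/P.
  rewrite P_i Pa ab Pb addr0 => /eqP; rewrite gt_eqF // !addr_gt0 ?ltr01 //;
    exact: (eigval0_gt0 iO iO).
- move=> PA; apply: (block_P_polynomial3 iO iO (A := i) (B := A) (D := B)) => //.
  + by rewrite perm_sym.
  + by move=> h; rewrite eigval_diag // oner_eq0.
  + by move=> h /PA; rewrite !eigval_diag // !divr1.
- move=> PB; apply: (block_P_polynomial3 iO iO (A := i) (B := B) (D := A)) => //.
  + by rewrite perm_sym (perm_trans sE) // perm_cons (perm_catC [:: A] [:: B]).
  + by move=> h; rewrite eigval_diag // oner_eq0.
  + by move=> h /PB; rewrite !eigval_diag // !divr1.
Qed.

Lemma P_polynomial_rank3_offdiag i j : i \in Omega C -> j \in Omega C ->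
  i != j -> #|block_rels C i j| = 3%N -> block_P_polynomial i j.
Proof.
move=> iO jO ij card3; pose P := @eigval X K C E i j.
move: (cardE (block_rels C i j)); rewrite card3.
case E0: (enum _) => [|A [|B [|D []]]] // _.
have memE R : R \in block_rels C i j = (R \in [:: A; B; D]).
  by rewrite -E0 mem_enum.
have Ppos R : R \in [:: A; B; D] -> 0 < P R ord0.
  by rewrite -memE; apply: eigval0_gt0.
pose y h R := P R h / P R ord0.
have [h1 [h2 [h10 h20 h12]]] := nonzero_index3 card3.
pose clash U V := obstructed (y h1 U) (y h1 V) || obstructed (y h2 U) (y h2 V).
have good U V W : perm_eq [:: U; V; W] [:: A; B; D] ->
    clash U V = false -> block_P_polynomial i j.
  move=> UVW /negbT; rewrite /clash /obstructed !negb_or.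
  move=> /andP[/andP[U1 V1] /andP[U2 V2]].
  have PU : 0 < P U ord0 by rewrite Ppos // -(perm_mem UVW) mem_head.
  have PV : 0 < P V ord0 by rewrite Ppos // -(perm_mem UVW) !inE eqxx orbT.
  have yU h : h != ord0 -> y h U != 0 by case/h12 => ->.
  have yV h : h != ord0 -> y h U != y h V by case/h12 => ->.
  have PUN0 h : P U h != 0.
    have [->|/yU] := eqVneq h ord0; first by rewrite gt_eqF.
    by apply: contraNneq => PUh; rewrite /y PUh mul0r.
  apply: (block_P_polynomial3 iO jO (A := U) (B := V) (D := W)) => //.
  - by rewrite E0.
  - by move=> e; rewrite e eqxx in ij.
  - move=> h /yV; apply: contraNneq; rewrite -!/(P _ _) => e; apply/eqP.
    have -> : y h V = P V h / P U h * (P U h / P V ord0).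
      by rewrite /y mulrA divfK.
    by rewrite e /y; field; rewrite !gt_eqF // PUN0.
have [s _ sumP] := sum_eigval iO jO.
have few h : h != ord0 ->
    (obstructed (y h A) (y h B) + obstructed (y h A) (y h D)
     + obstructed (y h B) (y h A) + obstructed (y h B) (y h D)
     + obstructed (y h D) (y h A) + obstructed (y h D) (y h B) <= 2)%N.
  move=> h0; have yE R : R \in [:: A; B; D] -> P R ord0 * y h R = P R h.
    by move=> /Ppos PR; rewrite /y mulrC divfK // gt_eqF.
  apply: (@obstructed_pairs_le2 K (P A ord0) (P B ord0) (P D ord0));
    rewrite ?Ppos ?yE ?inE ?eqxx ?orbT //.
    have := sumP h; rewrite (negPf h0) mulr0 -big_enum E0 /= !big_cons big_nil.
    by rewrite addr0 addrA.
  have [R RB PR0] := eigval_neq0 iO jO h.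
  have yR : y h R != 0.
    by rewrite /y mulf_neq0 // invr_neq0 // gt_eqF // Ppos -?memE.
  by move: RB yR; rewrite memE !inE => /or3P[] /eqP-> ->; rewrite ?orbT.
(* If every pair clashed, the two nonzero indices would obstruct six ordered
   pairs, whereas each obstructs at most two. *)
case AB: (clash A B); last by apply: good AB.
case AD: (clash A D); last by apply: (good A D B) AD; case: (perm_eq3 A B D).
case BA: (clash B A); last by apply: (good B A D) BA; case: (perm_eq3 A B D).
case BD: (clash B D); last by apply: (good B D A) BD; case: (perm_eq3 A B D).
case DA: (clash D A); last by apply: (good D A B) DA; case: (perm_eq3 A B D).
case DB: (clash D B); last by apply: (good D B A) DB; case: (perm_eq3 A B D).
have orb_addn_gt0 (b b' : bool) : b || b' -> (1 <= b + b')%N.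
  by case: b b' => [] [].
move: AB AD BA BD DA DB (few h1 h10) (few h2 h20).
move=> /orb_addn_gt0 AB /orb_addn_gt0 AD /orb_addn_gt0 BA.
move=> /orb_addn_gt0 BD /orb_addn_gt0 DA /orb_addn_gt0 DB.
move: AB AD BA BD DA DB.
do 12!move: (nat_of_bool (obstructed _ _)) => ?; lia.
Qed.

End Eigenvalues.

Theorem proposition3p5 (R : realType) (X : finType)
    (C : coherent_configuration X)
    (E : {set X * X} -> {set X * X} -> nat -> 'M[R[i]]_#|X|)
    (symC : symmetric_fibers C)
    (basisE : matrix_unit_basis C E)
    (typeC : has_type C 2 2 3 \/ has_type C 3 2 3 \/ has_type C 3 3 3) :
  P_polynomial C E.
Proof.
move=> i j iO jO.
have rank23 : #|block_rels C i j| = 2%N \/ #|block_rels C i j| = 3%N.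
  by move: iO jO; case: typeC => [|[]] [i1 [i2 [_ -> c11 [c12 c21] c22]]];
    rewrite !inE => /orP[] /eqP-> /orP[] /eqP->; rewrite ?c11 ?c12 ?c21 ?c22;
    auto.
case: rank23 => card; first exact: P_polynomial_rank2.
have [ij|ij] := eqVneq i j; last exact: P_polynomial_rank3_offdiag.
by rewrite -ij in card *; apply: P_polynomial_rank3_diag.
Qed.
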